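(* Let $f:X\longrightarrow X$ be a continuous map on a metric space $(X,d)$, let $\varepsilon,c,b,r>0$, and let $0\leq a<b$. The following statements hold: (a) Assume that there exists $S\subset X$ fulfilling any of the following conditions: $S$ is LY, MLY, D1 or D2 scrambled (resp. LY, MLY, D1 or D2 $\varepsilon$-scrambled); $S$ is D1$\tfrac12$ scrambled (resp. D1$\tfrac12$ U-scrambled); $S$ is D2$\tfrac12$ scrambled (resp. D2$\tfrac12$ $(\varepsilon,c)$-scrambled); or $S$ is D3 scrambled (resp. D3 $(a,b)$-scrambled), for $f$ and $d$. Then there exists a set $\overline{S}\subset\mathcal{K}(X)$ with the same cardinality and fulfilling the same property as $S$ but with respect to $\overline{f}$ and $d_H$. (b) Assume that there exists $\overline{S}\subset\mathcal{K}(X)$ fulfilling any of the following conditions: $\overline{S}$ is LY, MLY, D1 or D2 scrambled (resp. $\varepsilon$-scrambled); $\overline{S}$ is D1$\tfrac12$ scrambled (resp. U-scrambled); $\overline{S}$ is D2$\tfrac12$ scrambled (resp. $(\varepsilon,c)$-scrambled); or $\overline{S}$ is D3 scrambled (resp. $(a,b)$-scrambled), for $\overline{f}$ and $d_H$. Then there exists $\hat{S}\subset\mathcal{F}(X)$ with the same cardinality and fulfilling the same property as $\overline{S}$ but with respect to $\hat{f}$ and any $\rho\in\{d_\infty,d_0,d_S\}$. (c) Assume that there exists $\overline{S}\subset\mathcal{K}(X)$ fulfilling any of the following conditions: $\overline{S}$ is LY, D1 or D2 scrambled (resp. $\varepsilon$-scrambled); $\overline{S}$ is D1$\tfrac12$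 scrambled (resp. U-scrambled); or $\overline{S}$ is D2$\tfrac12$ scrambled (resp. $(\varepsilon,c)$-scrambled), for $\overline{f}$ and $d_H$. Then, for $\varepsilon':=\min\{\varepsilon,1\}$, there exists a set $\hat{S}\subset\mathcal{F}(X)$ with the same cardinality as $\overline{S}$ and such that, respectively, $\hat{S}$ is LY, D1 or D2 scrambled (resp. $\varepsilon'$-scrambled), $\hat{S}$ is D1$\tfrac12$ scrambled (resp. U-scrambled), or $\hat{S}$ is D2$\tfrac12$ scrambled (resp. $(\varepsilon',c)$-scrambled), for $\hat{f}$ and $d_E$. (d) Assume that there exists $\overline{S}\subset\mathcal{K}(X)$ that is MLY scrambled (resp. MLY $\varepsilon$-scrambled) for $\overline{f}$ and $d_H$, and suppose also that the set $\{d_H(\overline{f}^j(K),\overline{f}^j(L)) : j\in\mathbb{N}\}$ is bounded (resp. bounded by $r>0$) for every pair $K,L\in\overline{S}$. Then there exists a set $\hat{S}\subset\mathcal{F}(X)$ with the same cardinality as $\overline{S}$ that is MLY scrambled (resp. MLY $(\tfrac{\varepsilon}{r+1})^2$-scrambled) with respect to $\hat{f}$ and $d_E$. (e) Assume that there exists $\overline{S}\subset\mathcal{K}(X)$ that is D3 scrambled (resp. D3 $(a,b)$-scrambled) for $\overline{f}$ and $d_H$, and suppose also that for each pair $K,L\in\overline{S}$ with $K\neq L$ the pair $(K,L)$ is a D3 $(a_{(K,L)},b_{(K,L)})$-pair with $a_{(K,L)}<1$ (resp. suppose that $a<1$). Then there is $\hat{S}\subset\mathcal{F}(X)$ with the same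 cardinality as $\overline{S}$ that is D3 scrambled (resp. D3 $(a,\min\{b,1\})$-scrambled) for $\hat{f}$ and $d_E$. (f) If the dynamical system $(X,f)$ has any of the properties LYC, MLYC, DC1, DC1$\tfrac12$, DC2, DC2$\tfrac12$, DC3, U-LYC, U-MLYC, U-DC1, U-DC1$\tfrac12$, U-DC2, U-DC2$\tfrac12$ or U-DC3, for the metric $d$, then $(\mathcal{K}(X),\overline{f})$ has the same property for the metric $d_H$. (g) If $(\mathcal{K}(X),\overline{f})$ has any of the properties LYC, MLYC, DC1, DC1$\tfrac12$, DC2, DC2$\tfrac12$, DC3, U-LYC, U-MLYC, U-DC1, U-DC1$\tfrac12$, U-DC2, U-DC2$\tfrac12$ or U-DC3, for the metric $d_H$, then so do $(\mathcal{F}_\infty(X),\hat{f})$, $(\mathcal{F}_0(X),\hat{f})$ and $(\mathcal{F}_S(X),\hat{f})$. (h) If $(\mathcal{K}(X),\overline{f})$ has any of the properties LYC, DC1, DC1$\tfrac12$, DC2, DC2$\tfrac12$, U-LYC, U-DC1, U-DC1$\tfrac12$, U-DC2 or U-DC2$\tfrac12$, for $d_H$, then so does $(\mathcal{F}_E(X),\hat{f})$. (i) If $(\mathcal{K}(X),\overline{f})$ is MLYC or U-MLYC for $d_H$, and if the metric space $(X,d)$ is bounded, then $(\mathcal{F}_E(X),\hat{f})$ is MLYC or U-MLYC, respectively. (j) If $(\mathcal{K}(X),\overline{f})$ is DC3 or U-DC3 for $d_H$, and if $\operatorname{diam}_d(X)\leq 1$, then $(\mathcal{F}_E(X),\hat{f})$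 is DC3 or U-DC3, respectively.
   Context: Notation: $\mathbb{N}=\{1,2,3,\dots\}$, $\mathbb{I}=[0,1]$, and $\operatorname{diam}_d(X):=\sup\{d(x,y): x,y\in X\}$. **Chaos notions.** For $A\subset\mathbb{N}$, $\underline{\operatorname{dens}}(A):=\liminf_{n\to\infty}\frac{\#(A\cap[1,n])}{n}$ and $\overline{\operatorname{dens}}(A):=\limsup_{n\to\infty}\frac{\#(A\cap[1,n])}{n}$. Let $g:Y\to Y$ be a continuous map on a metric space $(Y,\rho)$, and let $(x,y)\in Y\times Y$. For $\delta>0$ put $\Phi_{(x,y)}(\delta):=\underline{\operatorname{dens}}(\{j\in\mathbb{N}: \rho(g^j(x),g^j(y))<\delta\})$ and $\Phi^*_{(x,y)}(\delta):=\overline{\operatorname{dens}}(\{j\in\mathbb{N}: \rho(g^j(x),g^j(y))<\delta\})$. For $g$ and $\rho$, the pair $(x,y)$ is: - a LY $\varepsilon$-pair ($\varepsilon>0$) if $\limsup_{n}\rho(g^n(x),g^n(y))\geq\varepsilon$ and $\liminf_{n}\rho(g^n(x),g^n(y))=0$; - a MLY $\varepsilon$-pair ($\varepsilon>0$) if $\limsup_n\frac1n\sum_{j=1}^n\rho(g^j(x),g^j(y))\geq\varepsilon$ and $\liminf_n\frac1n\sum_{j=1}^n\rho(g^j(x),g^j(y))=0$; - a D1 $\varepsilon$-pair ($\varepsilon>0$) if $\Phi_{(x,y)}(\varepsilon)=0$ and $\Phi^*_{(x,y)}(\delta)=1$ for all $\delta>0$; - a D1$\tfrac12$ pair if $\lim_{\delta\to0^+}\Phi_{(x,y)}(\delta)=0$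 and $\Phi^*_{(x,y)}(\delta)=1$ for all $\delta>0$; - a D2 $\varepsilon$-pair ($0<\varepsilon\leq1$) if $\Phi_{(x,y)}(\varepsilon)\leq1-\varepsilon$ and $\Phi^*_{(x,y)}(\delta)=1$ for all $\delta>0$; - a D2$\tfrac12$ $(\varepsilon,c)$-pair ($\varepsilon,c>0$) if $\Phi_{(x,y)}(\delta)<c<\Phi^*_{(x,y)}(\delta)$ whenever $0<\delta\leq\varepsilon$; - a D3 $(a,b)$-pair ($0\leq a<b$) if $\Phi_{(x,y)}(\delta)<\Phi^*_{(x,y)}(\delta)$ whenever $a<\delta<b$. A LY (MLY, D1, D2, D2$\tfrac12$, D3) pair is a pair that is such a pair for some value of the parameter(s). For $P\in\{$LY, MLY, D1, D1$\tfrac12$, D2, D2$\tfrac12$, D3$\}$, a set $S\subset Y$ is $P$ scrambled if every pair $(x,y)$ of distinct points of $S$ is a $P$ pair; it is $P$ $\varepsilon$-scrambled (for LY, MLY, D1, D2; with $0<\varepsilon\le 1$ for D2), D2$\tfrac12$ $(\varepsilon,c)$-scrambled, or D3 $(a,b)$-scrambled if every pair of distinct points of $S$ is a $P$ pair with those same parameters. $S$ is D1$\tfrac12$ U-scrambled if it is D1$\tfrac12$ scrambled and $\lim_{\delta\to0^+}\sup\{\Phi_{(x,y)}(\delta): x,y\in S,\ x\neq y\}=0$. The system $(Y,g)$ is LYC, MLYC, DC1, DC1$\tfrac12$, DC2, DC2$\tfrac12$, DC3 (for $\rho$) if there is an uncountable $S\subset Y$ that is, respectively, LY, MLY, D1,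 D1$\tfrac12$, D2, D2$\tfrac12$, D3 scrambled. It is U-LYC, U-MLYC, U-DC1, U-DC2 if there is an uncountable $S$ that is, respectively, LY, MLY, D1, D2 $\varepsilon$-scrambled for some $\varepsilon>0$; U-DC1$\tfrac12$ if there is an uncountable D1$\tfrac12$ U-scrambled set; U-DC2$\tfrac12$ if there is an uncountable D2$\tfrac12$ $(\varepsilon,c)$-scrambled set for some $\varepsilon,c>0$; U-DC3 if there is an uncountable D3 $(a,b)$-scrambled set for some $0\leq a<b$. **Hyperspaces.** $\mathcal{K}(X)$ is the set of non-empty compact subsets of $X$. For non-empty closed sets $C_1,C_2$, $d_H(C_1,C_2):=\max\{\sup_{x_1\in C_1}\inf_{x_2\in C_2}d(x_1,x_2),\ \sup_{x_2\in C_2}\inf_{x_1\in C_1}d(x_2,x_1)\}$ (Hausdorff metric on $\mathcal{K}(X)$). $\overline{f}:\mathcal{K}(X)\to\mathcal{K}(X)$ is $\overline{f}(K):=f(K)$. **Fuzzy sets.** $\mathcal{F}(X)$ is the set of upper-semicontinuous functions $u:X\to\mathbb{I}$ such that $u_0:=\overline{\{x: u(x)>0\}}$ is compact and $u_1\neq\varnothing$, where $u_\alpha:=\{x: u(x)\geq\alpha\}$ for $\alpha\in\,]0,1]$. The Zadeh extension $\hat{f}:\mathcal{F}(X)\to\mathcal{F}(X)$ is $[\hat{f}(u)](x):=\sup\{u(y): y\in f^{-1}(\{x\})\}$ if $f^{-1}(\{x\})\neq\varnothing$, and $0$ otherwise (it is well defined and continuous for all metrics below). Metrics on $\mathcal{F}(X)$: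 - $d_\infty(u,v):=\sup_{\alpha\in\mathbb{I}}d_H(u_\alpha,v_\alpha)$; - $d_0(u,v):=\inf\{\varepsilon>0:$ there is a strictly increasing homeomorphism $\xi:\mathbb{I}\to\mathbb{I}$ with $\sup_{\alpha\in\mathbb{I}}|\xi(\alpha)-\alpha|\leq\varepsilon$ and $d_\infty(u,\xi\circ v)\leq\varepsilon\}$; - on $X\times\mathbb{I}$ let $\overline{d}((x,\alpha),(y,\beta)):=\max\{d(x,y),|\alpha-\beta|\}$, and let $\operatorname{end}(u):=\{(x,\alpha)\in X\times\mathbb{I}: u(x)\geq\alpha\}$, $\operatorname{send}(u):=\operatorname{end}(u)\cap(u_0\times\mathbb{I})$. Then $d_S(u,v)$ is the Hausdorff distance (induced by $\overline{d}$) between $\operatorname{send}(u)$ and $\operatorname{send}(v)$, and $d_E(u,v)$ is the Hausdorff distance (induced by $\overline{d}$) between $\operatorname{end}(u)$ and $\operatorname{end}(v)$. $\mathcal{F}_\infty(X),\mathcal{F}_0(X),\mathcal{F}_S(X),\mathcal{F}_E(X)$ denote $\mathcal{F}(X)$ with the metric $d_\infty,d_0,d_S,d_E$ respectively. *)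

(* Defs.v *)
From mathcomp Require Import all_boot all_order all_algebra finmap.
From mathcomp Require Import all_classical all_reals.
From mathcomp Require Import ereal topology normedtype sequences.

Set Implicit Arguments.
Unset Strict Implicit.
Unset Printing Implicit Defensive.

Import Order.TTheory GRing.Theory Num.Theory.
Import numFieldTopology.Exports numFieldNormedType.Exports.

Local Open Scope classical_set_scope.
Local Open Scope ring_scope.

Section Density.
Context {R : realType}.
Implicit Type A : set nat.

(* The term of index 0 is 0 / 0 = 0; it does not affect the limits. All terms
   lie in [0, 1], so the real-valued limn_inf and limn_sup are the usual ones. *)
Definition freq A (n : nat) : R :=
  #|` fset_set (A `&` [set j | (1 <= j <= n)%N])|%:R / n%:R.

Definition lower_dens A : R := limn_inf (freq A).
Definition upper_dens A : R := limn_sup (freq A).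

End Density.

(* The phase space is a set Y of points of a type T, with a distance rho and a
   map g given on all of T: this covers X itself (Y = setT) as well as K(X)
   and F(X), which are sets of subsets of X and of functions on X. *)
Section Chaos.
Context {R : realType} {T : Type} (rho : T -> T -> R) (g : T -> T).
Implicit Types (x y : T) (S Y : set T) (eps c a b : R).

Definition orbit_dist x y (j : nat) : R := rho (iter j g x) (iter j g y).

Definition mean_dist x y (n : nat) : R :=
  (\sum_(1 <= j < n.+1) orbit_dist x y j) / n%:R.

Definition Phi x y (delta : R) : R :=
  lower_dens [set j | orbit_dist x y j < delta].
Definition Phi_star x y (delta : R) : R :=
  upper_dens [set j | orbit_dist x y j < delta].

(* Distances along orbits may be unbounded, so the limits superior are taken in
   the extended real line. *)
Definition LY_eps_pair eps x y :=
  [/\ 0 < eps,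
      (eps%:E <= limn_esup (EFin \o orbit_dist x y))%E
    & limn_einf (EFin \o orbit_dist x y) = 0%E].

Definition MLY_eps_pair eps x y :=
  [/\ 0 < eps,
      (eps%:E <= limn_esup (EFin \o mean_dist x y))%E
    & limn_einf (EFin \o mean_dist x y) = 0%E].

Definition D1_eps_pair eps x y :=
  [/\ 0 < eps, Phi x y eps = 0
    & forall delta, 0 < delta -> Phi_star x y delta = 1].

Definition D1half_pair x y :=
  (Phi x y @ 0^'+ --> (0 : R)) /\
  (forall delta, 0 < delta -> Phi_star x y delta = 1).

Definition D2_eps_pair eps x y :=
  [/\ 0 < eps <= 1, Phi x y eps <= 1 - eps
    & forall delta, 0 < delta -> Phi_star x y delta = 1].

Definition D2half_eps_pair eps c x y :=
  [/\ 0 < eps, 0 < c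
    & forall delta, 0 < delta <= eps ->
        Phi x y delta < c /\ c < Phi_star x y delta].

Definition D3_ab_pair a b x y :=
  [/\ 0 <= a, a < b
    & forall delta, a < delta < b -> Phi x y delta < Phi_star x y delta].

Definition pairwise_distinct (P : T -> T -> Prop) S :=
  forall x y, S x -> S y -> x <> y -> P x y.

(* If S has at most one point the supremum is sup set0 = 0, the least element of
   [0, 1]. *)
Definition D1half_U S :=
  pairwise_distinct D1half_pair S /\
  ((fun delta : R =>
      sup [set Phi p.1 p.2 delta | p in [set p | [/\ S p.1, S p.2 & p.1 <> p.2]]])
    @ 0^'+ --> (0 : R)).

End Chaos.

Inductive chaos_kind := LY | MLY | D1 | D1half | D2 | D2half | D3.

Section Scrambled.
Context {R : realType} {T : Type}.
Implicit Types (P : chaos_kind) (rho : T -> T -> R) (g : T -> T).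
Implicit Types (S Y : set T) (eps c a b : R).

Definition chaos_pair P rho g (x y : T) : Prop :=
  match P with
  | LY => exists eps, LY_eps_pair rho g eps x y
  | MLY => exists eps, MLY_eps_pair rho g eps x y
  | D1 => exists eps, D1_eps_pair rho g eps x y
  | D1half => D1half_pair rho g x y
  | D2 => exists eps, D2_eps_pair rho g eps x y
  | D2half => exists eps c, D2half_eps_pair rho g eps c x y
  | D3 => exists a b, D3_ab_pair rho g a b x y
  end.

Definition scrambled P rho g S := pairwise_distinct (chaos_pair P rho g) S.

(* eps-scrambled for LY, MLY, D1, D2; U-scrambled for D1half; (eps, c)-scrambled
   for D2half; (a, b)-scrambled for D3. The other parameters are ignored. *)
Definition unif_scrambled P eps c a b rho g S : Prop :=
  match P with
  | LY => pairwise_distinct (LY_eps_pair rho g eps) S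
  | MLY => pairwise_distinct (MLY_eps_pair rho g eps) S
  | D1 => pairwise_distinct (D1_eps_pair rho g eps) S
  | D1half => D1half_U rho g S
  | D2 => pairwise_distinct (D2_eps_pair rho g eps) S
  | D2half => pairwise_distinct (D2half_eps_pair rho g eps c) S
  | D3 => pairwise_distinct (D3_ab_pair rho g a b) S
  end.

(* With unif_chaotic below: LYC, MLYC, DC1, DC1half, DC2, DC2half, DC3 for the
   system (Y, g), and their U- versions. *)
Definition chaotic P Y rho g :=
  exists S, [/\ S `<=` Y, ~ countable S & scrambled P rho g S].

Definition unif_chaotic P Y rho g :=
  exists S, [/\ S `<=` Y, ~ countable S
    & exists eps c a b, unif_scrambled P eps c a b rho g S].

End Scrambled.

Definition hausdorff_dist {R : realType} {T : Type} (dist : T -> T -> R)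
    (A B : set T) : R :=
  Num.max (sup [set inf [set dist x y | y in B] | x in A])
          (sup [set inf [set dist y x | x in A] | y in B]).

Section Hyperspaces.
Context {R : realType} {X : metricType R}.
Implicit Types (u v : X -> R) (f : X -> X).

Definition hyperspace : set (set X) := [set K | K !=set0 /\ compact K].

Definition hyper_map f (K : set X) : set X := f @` K.

Definition d_H : set X -> set X -> R := hausdorff_dist (@mdist R X).

Definition diam : \bar R := ereal_sup [set (mdist p.1 p.2 : R)%:E | p in [set: X * X]].

Definition bounded_space := exists M : R, forall x y : X, mdist x y <= M.

Definition upper_semicontinuous u :=
  forall x a, u x < a -> \forall y \near x, u y < a.

Definition level u (alpha : R) : set X :=
  if alpha == 0 then closure [set x | 0 < u x] else [set x | alpha <= u x].

Definition fuzzy_sets : set (X -> R) :=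
  [set u | [/\ forall x, 0 <= u x <= 1, upper_semicontinuous u,
               compact (level u 0) & level u 1 !=set0]].

Definition zadeh f u : X -> R := fun x =>
  if `[< f @^-1` [set x] !=set0 >] then sup (u @` (f @^-1` [set x])) else 0.

Definition d_infty u v : R :=
  sup [set d_H (level u alpha) (level v alpha) | alpha in `[0, 1]%classic].

(* Increasing homeomorphisms of [0, 1], given by a function on R of which only
   the restriction to [0, 1] matters; zeta is the inverse. *)
Definition incr_homeo_I (xi : R -> R) : Prop :=
  {in `[0, 1] &, {homo xi : s t / s < t}} /\
  exists zeta : R -> R,
    [/\ {homo xi : t / t \in `[0, 1]}, {homo zeta : t / t \in `[0, 1]},
        {in `[0, 1], cancel xi zeta} & {in `[0, 1], cancel zeta xi}] /\
    ({within `[0, 1], continuous xi} /\ {within `[0, 1], continuous zeta}).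

Definition d_zero u v : R :=
  inf [set e | 0 < e /\ exists xi : R -> R,
    [/\ incr_homeo_I xi,
        sup [set `|xi alpha - alpha| | alpha in `[0, 1]%classic] <= e
      & d_infty u (xi \o v) <= e]].

Definition dbar (p q : X * R) : R := Num.max (mdist p.1 q.1) `|p.2 - q.2|.

Definition endograph u : set (X * R) :=
  [set p | 0 <= p.2 <= 1 /\ p.2 <= u p.1].

Definition sendograph u : set (X * R) :=
  endograph u `&` (level u 0 `*` `[0, 1]%classic).

Definition d_send u v : R := hausdorff_dist dbar (sendograph u) (sendograph v).
Definition d_end u v : R := hausdorff_dist dbar (endograph u) (endograph v).

End Hyperspaces.
Arguments hyperspace {R} X.
Arguments fuzzy_sets {R} X.
Arguments diam {R} X.
Arguments bounded_space {R} X.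

(* Main.v *)
Require Import Defs.
From mathcomp Require Import all_boot all_order all_algebra.
From mathcomp Require Import all_classical all_reals.
From mathcomp Require Import ereal topology normedtype sequences numfun.

Set Implicit Arguments.
Unset Strict Implicit.
Unset Printing Implicit Defensive.

Import Order.TTheory GRing.Theory Num.Theory.
Import numFieldTopology.Exports numFieldNormedType.Exports.

Local Open Scope classical_set_scope.
Local Open Scope card_scope.
Local Open Scope ring_scope.

(** The map x |-> {x} embeds X into its hyperspace, and K |-> \1_K embeds the
    hyperspace into the fuzzy sets. Both commute with the induced maps
    ([iter_hyper_map_set1], [iter_zadeh_ind]), and distances are transported by
      d_H {x} {y} = d x y                                     ([d_H_set1]),
      rho \1_K \1_L = d_H K L   for rho = d_infty, d_zero, d_send
                           ([d_infty_ind], [d_zero_ind], [d_send_ind]),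
      d_end \1_K \1_L = min (d_H K L) 1                       ([d_end_ind]).
    The formula for d_end comes from the floor X * {0}, which all endographs
    share: a point of height t is never farther than t from another endograph.

    All the notions of chaotic pair depend only on the sequence of distances
    along the orbits of the two points ([unif_pair_same]). The image of a
    scrambled set under an isometric embedding is therefore scrambled with the
    same parameters, which settles everything except d_end.

    For d_end the distances along the orbits are truncated at 1. Frequencies
    of closeness below a threshold of at most 1 do not change, and above 1
    the frequency becomes full, so the conditions stated with thresholds survive
    with parameters cut down to 1; for D3 this asks that the interval of
    thresholds meet ]0, 1[. Averages are different, since a few large distances
    can dominate them: a bound r on the distances is needed, and then
    truncation divides averages by at most r + 1 ([MLY_trunc]). If the
    diameter of X is at most 1, d_H never exceeds 1 and nothing is truncated
    ([isometry_end]). *)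

(** * Limits superior and inferior of real sequences *)

Section RealSequences.
Context {R : realType}.
Implicit Types (u : nat -> R) (e t : R).

(** Limits superior and inferior are used below only in the form: values beyond
    each threshold occur infinitely often. This form passes through pointwise
    comparisons of sequences without any limit being computed. *)
Lemma limn_esup_geP u e :
  (e%:E <= limn_esup (EFin \o u))%E <->
  (forall t, t < e -> forall n, exists2 k, (n <= k)%N & t < u k).
Proof.
have -> : limn_esup (EFin \o u) = ereal_inf (range (esups (EFin \o u))).
  by rewrite limn_esup_lim; apply/cvg_lim => //; exact: cvg_esups_inf.
split=> [/ereal_infP eu t te n|eu].
  have : (t%:E < esups (EFin \o u) n)%E.
    by rewrite (@lt_le_trans _ _ e%:E) ?lte_fin//; apply: eu; exists n.
  by move=> /ereal_sup_gt[_ [k /= nk <-]]; rewrite lte_fin; exists k.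
apply/ereal_infP => _ [n _ <-]; apply/lee_subgt0Pr => d d0.
have /eu/(_ n)[k nk tk] : e - d < e by rewrite gtrBl.
apply: le_ereal_sup_tmp; exists (u k)%:E; first by exists k.
by rewrite -EFinB lee_fin ltW.
Qed.

Lemma limn_einf_eq0P u : (forall n, 0 <= u n) ->
  limn_einf (EFin \o u) = 0%E <->
  (forall t, 0 < t -> forall n, exists2 k, (n <= k)%N & u k < t).
Proof.
move=> u0.
have ge0 : (0 <= limn_einf (EFin \o u))%E.
  rewrite limn_einf_lim; apply: lime_ge; first exact: is_cvg_einfs.
  apply: nearW => n; apply: le_ereal_inf_tmp => _ [k _ <-].
  by rewrite lee_fin.
have -> : limn_einf (EFin \o u) = 0%E <->
    (0%:E <= limn_esup (EFin \o (fun n => (- u n)%R)))%E.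
  have -> : EFin \o (fun n => (- u n)%R) = -%E \o (EFin \o u) by exact/funext.
  rewrite limn_esupN oppe_ge0; split=> [->//|le0].
  by apply/eqP; rewrite eq_le le0.
rewrite limn_esup_geP; split=> H t t0 n.
  have [|k nk] := H (- t) _ n; first by rewrite oppr_lt0.
  by rewrite ltrN2; exists k.
have [|k nk] := H (- t) _ n; first by rewrite oppr_gt0.
by rewrite ltrNr; exists k.
Qed.

End RealSequences.

(** * Densities *)

Section Densities.
Context {R : realType}.
Implicit Types A B : set nat.

Lemma initial_segment_card n : [set j | (1 <= j <= n)%N] #= `I_n.
Proof.
rewrite (_ : [set j | _] = succn @` `I_n).
  by apply: inj_card_eq => i j _ _ /succn_inj.
by apply/seteqP; split=> [[|j]//= jn|_ /= [j jn <-]//]; exists j.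
Qed.

Lemma finite_initial_segment n : finite_set [set j | (1 <= j <= n)%N].
Proof. by apply/finite_setP; exists n; exact: initial_segment_card. Qed.

Lemma freq_ge0 A n : 0 <= freq A n :> R.
Proof. by rewrite divr_ge0. Qed.

Lemma le_freq A B n : A `<=` B -> freq A n <= freq B n :> R.
Proof.
move=> AB; rewrite ler_wpM2r ?invr_ge0// ler_nat.
apply: finmap.fsubset_leq_card; rewrite -fset_set_sub.
- exact: setSI.
- exact/finite_setIr/finite_initial_segment.
- exact/finite_setIr/finite_initial_segment.
Qed.

Lemma freq_setT n : (0 < n)%N -> freq setT n = 1 :> R.
Proof.
move=> n0; rewrite /freq setTI (card_fset_set (initial_segment_card n)).
by rewrite divff// pnatr_eq0 -lt0n.
Qed.

Lemma freq_le1 A n : freq A n <= 1 :> R.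
Proof.
case: n => [|n]; first by rewrite /freq invr0 mulr0.
by rewrite -(@freq_setT n.+1)// le_freq.
Qed.

(** Monotone and bounded; the real-valued limit inferior is the limit of these
    infima only once they are known to converge. *)
Lemma infs_freq_cvg A : cvgn (infs (freq A : nat -> R^o)).
Proof.
have bnd n : 0 <= inf (sdrop (freq A : nat -> R) n) <= 1.
  have ne : sdrop (freq A : nat -> R) n !=set0 by exists (freq A n); exists n => /=.
  have lb : lbound (sdrop (freq A : nat -> R) n) 0.
    by move=> _ [k _ <-]; exact: freq_ge0.
  rewrite lb_le_inf//=; apply: le_trans (freq_le1 A n).
  by apply: ge_inf; [exists 0|exists n => /=].
apply: nondecreasing_is_cvgn; last by exists 1 => _ [n _ <-]; case/andP: (bnd n).
by apply: nondecreasing_infs; exists 0 => _ [n _ <-]; exact: freq_ge0.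
Qed.

Lemma lower_dens_ge0 A : 0 <= lower_dens A :> R.
Proof.
apply: limr_ge; first exact: infs_freq_cvg.
apply: nearW => n; apply: lb_le_inf; first by exists (freq A n); exists n => /=.
by move=> _ [k _ <-]; exact: freq_ge0.
Qed.

Lemma le_lower_dens A B : A `<=` B -> lower_dens A <= lower_dens B :> R.
Proof.
move=> AB; apply: ler_lim; [exact: infs_freq_cvg|exact: infs_freq_cvg|].
apply: nearW => n; apply: lb_le_inf; first by exists (freq B n); exists n => /=.
move=> _ [k /= nk <-]; apply: le_trans (le_freq k AB).
by apply: ge_inf; [exists 0 => _ [m _ <-]; exact: freq_ge0|exists k].
Qed.

Lemma upper_dens_setT : upper_dens setT = 1 :> R.
Proof.
have f1 : (freq setT : nat -> R^o) @ \oo --> (1 : R^o).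
  apply: cvg_near_cst; exists 1%N => //= n n1; exact: freq_setT.
by rewrite /upper_dens (cvg_limn_inf_sup f1).2.
Qed.

End Densities.

(** * Pairs and their distances along the orbits *)

Section Pairs.
Context {R : realType} {T : Type}.
Implicit Types (rho : T -> T -> R) (g : T -> T) (x y : T) (eps c a b : R).

(** The pair relation behind both ways of being scrambled: its parameters are
    quantified per pair in the plain notion and fixed in the uniform one. *)
Definition unif_pair (P : chaos_kind) eps c a b rho g x y : Prop :=
  match P with
  | LY => LY_eps_pair rho g eps x y
  | MLY => MLY_eps_pair rho g eps x y
  | D1 => D1_eps_pair rho g eps x y
  | D1half => D1half_pair rho g x y
  | D2 => D2_eps_pair rho g eps x y
  | D2half => D2half_eps_pair rho g eps c x y
  | D3 => D3_ab_pair rho g a b x y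
  end.

Lemma chaos_pairP P rho g x y :
  chaos_pair P rho g x y <-> exists eps c a b, unif_pair P eps c a b rho g x y.
Proof.
case: P => /=; split.
- by move=> [e ?]; exists e, 0, 0, 0.
- by move=> [e [_ [_ [_ ?]]]]; exists e.
- by move=> [e ?]; exists e, 0, 0, 0.
- by move=> [e [_ [_ [_ ?]]]]; exists e.
- by move=> [e ?]; exists e, 0, 0, 0.
- by move=> [e [_ [_ [_ ?]]]]; exists e.
- by exists 0, 0, 0, 0.
- by move=> [_ [_ [_ [_ ?]]]].
- by move=> [e ?]; exists e, 0, 0, 0.
- by move=> [e [_ [_ [_ ?]]]]; exists e.
- by move=> [e [c ?]]; exists e, c, 0, 0.
- by move=> [e [c [_ [_ ?]]]]; exists e, c.
- by move=> [a [b ?]]; exists 0, 0, a, b.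
- by move=> [_ [_ [a [b ?]]]]; exists a, b.
Qed.

Definition sup_Phi rho g (S : set T) (delta : R) : R :=
  sup [set Phi rho g p.1 p.2 delta |
        p in [set p | [/\ S p.1, S p.2 & p.1 <> p.2]]].

(** The uniform D1half notion is the only one that is not a condition on single
    pairs: it adds a limit that is uniform over the whole set. *)
Lemma unif_scrambledP P eps c a b rho g (S : set T) :
  unif_scrambled P eps c a b rho g S <->
  pairwise_distinct (unif_pair P eps c a b rho g) S /\
  (P = D1half -> sup_Phi rho g S @ 0^'+ --> (0 : R)).
Proof.
by case: P; split=> // -[] // pS sS; split=> //; exact: sS.
Qed.

End Pairs.

Section SameOrbitDistances.
Context {R : realType} {T T' : Type}.
Context (rho : T -> T -> R) (g : T -> T) (rho' : T' -> T' -> R) (g' : T' -> T').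
Context (x y : T) (x' y' : T').
Hypothesis same : forall j, orbit_dist rho' g' x' y' j = orbit_dist rho g x y j.

(** Each notion of pair reads the two points only through the sequence of
    distances along their orbits. *)
Lemma unif_pair_same P (eps c a b : R) :
  unif_pair P eps c a b rho g x y -> unif_pair P eps c a b rho' g' x' y'.
Proof.
have oE : orbit_dist rho' g' x' y' = orbit_dist rho g x y by exact/funext.
have mE : mean_dist rho' g' x' y' = mean_dist rho g x y.
  by rewrite /mean_dist oE.
have PhiE : Phi rho' g' x' y' = Phi rho g x y by rewrite /Phi oE.
have PhisE : Phi_star rho' g' x' y' = Phi_star rho g x y by rewrite /Phi_star oE.
by case: P => /=; rewrite /LY_eps_pair /MLY_eps_pair /D1_eps_pair /D1half_pair
  /D2_eps_pair /D2half_eps_pair /D3_ab_pair ?oE ?mE ?PhiE ?PhisE.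
Qed.

End SameOrbitDistances.

(** * Truncation of the distances at 1 *)

Section Truncation.
Context {R : realType} {T T' : Type}.
Context (rho : T -> T -> R) (g : T -> T) (rho' : T' -> T' -> R) (g' : T' -> T').
Context (x y : T) (x' y' : T').
Local Notation dist := (orbit_dist rho g x y).
Local Notation tdist := (orbit_dist rho' g' x' y').
Hypothesis trunc : forall j, tdist j = Num.min (dist j) 1.
Hypothesis dist_ge0 : forall j, 0 <= dist j.
Implicit Types (eps c a b delta : R).

Let tdist_ge0 j : 0 <= tdist j.
Proof. by rewrite trunc le_min dist_ge0 ler01. Qed.

Let tdist_le j : tdist j <= dist j.
Proof. by rewrite trunc ge_min lexx. Qed.

(** Only thresholds above 1 see the truncation. *)
Lemma tdist_lt_small delta : delta <= 1 ->
  [set j | tdist j < delta] = [set j | dist j < delta].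
Proof.
move=> d1; apply/seteqP; split=> j /=; rewrite trunc gt_min.
  by case/orP=> // /(lt_le_trans)/(_ d1); rewrite ltxx.
by move=> ->.
Qed.

Lemma tdist_lt_large delta : 1 < delta -> [set j | tdist j < delta] = setT.
Proof.
by move=> d1; apply/seteqP; split=> j //= _; rewrite trunc gt_min d1 orbT.
Qed.

Lemma Phi_trunc delta : delta <= 1 ->
  Phi rho' g' x' y' delta = Phi rho g x y delta.
Proof. by move=> d1; rewrite /Phi tdist_lt_small. Qed.

Lemma Phi_star_trunc delta : delta <= 1 ->
  Phi_star rho' g' x' y' delta = Phi_star rho g x y delta.
Proof. by move=> d1; rewrite /Phi_star tdist_lt_small. Qed.

Lemma Phi_star_trunc1 : (forall delta, 0 < delta -> Phi_star rho g x y delta = 1) ->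
  forall delta, 0 < delta -> Phi_star rho' g' x' y' delta = 1.
Proof.
move=> P1 delta d0; have [d1|d1] := leP delta 1.
  by rewrite Phi_star_trunc// P1.
by rewrite /Phi_star tdist_lt_large// upper_dens_setT.
Qed.

(** Truncation at 1 preserves being above a threshold below 1. *)
Lemma LY_trunc eps : LY_eps_pair rho g eps x y ->
  LY_eps_pair rho' g' (Num.min eps 1) x' y'.
Proof.
case=> e0 /limn_esup_geP esup /(limn_einf_eq0P dist_ge0) einf; split.
- by rewrite lt_min e0 ltr01.
- apply/limn_esup_geP => t; rewrite lt_min => /andP[te t1] n.
  have [k nk tk] := esup t te n; exists k => //.
  by rewrite trunc lt_min tk t1.
- apply/limn_einf_eq0P => // t t0 n; have [k nk kt] := einf t t0 n.
  by exists k => //; exact: le_lt_trans (tdist_le k) kt.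
Qed.

(** If eps > 1 the parameter drops to 1, and [Phi] vanishes there because it is
    nondecreasing in the threshold. *)
Lemma D1_trunc eps : D1_eps_pair rho g eps x y ->
  D1_eps_pair rho' g' (Num.min eps 1) x' y'.
Proof.
case=> e0 Phi0 Phis1; split; last exact: Phi_star_trunc1.
  by rewrite lt_min e0 ltr01.
have m1 : Num.min eps 1 <= 1 by rewrite ge_min lexx orbT.
rewrite (Phi_trunc m1); apply/eqP; rewrite eq_le lower_dens_ge0 andbT -Phi0; apply: le_lower_dens => j /= jm.
by apply: lt_le_trans jm _; rewrite ge_min lexx.
Qed.

Lemma D1half_trunc : D1half_pair rho g x y -> D1half_pair rho' g' x' y'.
Proof.
case=> Phi0 Phis1; split; last exact: Phi_star_trunc1.
apply: cvg_trans Phi0; apply: near_eq_cvg.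
near=> delta; apply/esym/Phi_trunc; near: delta; exact: nbhs_right_le.
Unshelve. all: by end_near. Qed.

(** A D2 parameter never exceeds 1, so the minimum with 1 is eps itself. *)
Lemma D2_trunc eps : D2_eps_pair rho g eps x y ->
  D2_eps_pair rho' g' (Num.min eps 1) x' y'.
Proof.
case=> /andP[e0 e1] Phi0 Phis1; rewrite (min_l e1).
split; [by rewrite e0|by rewrite Phi_trunc|exact: Phi_star_trunc1].
Qed.

Lemma D2half_trunc eps c : D2half_eps_pair rho g eps c x y ->
  D2half_eps_pair rho' g' (Num.min eps 1) c x' y'.
Proof.
case=> e0 c0 Phic; split=> // [|delta]; first by rewrite lt_min e0 ltr01.
rewrite le_min => /and3P[d0 de d1].
by rewrite Phi_trunc// Phi_star_trunc//; apply: Phic; rewrite d0.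
Qed.

Lemma D3_trunc a b : a < 1 -> D3_ab_pair rho g a b x y ->
  D3_ab_pair rho' g' a (Num.min b 1) x' y'.
Proof.
move=> a1 [a0 ab Phiab]; split=> // [|delta]; first by rewrite lt_min ab a1.
rewrite lt_min => /and3P[ad db d1].
by rewrite Phi_trunc ?Phi_star_trunc ?ltW//; apply: Phiab; rewrite ad.
Qed.

Lemma unif_pair_trunc P eps c a b : P <> MLY -> P <> D3 ->
  unif_pair P eps c a b rho g x y ->
  unif_pair P (Num.min eps 1) c a b rho' g' x' y'.
Proof.
case: P => notMLY notD3.
- exact: LY_trunc.
- by case: notMLY.
- exact: D1_trunc.
- exact: D1half_trunc.
- exact: D2_trunc.
- exact: D2half_trunc.
- by case: notD3.
Qed.

Lemma mean_tdist_le n : mean_dist rho' g' x' y' n <= mean_dist rho g x y n.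
Proof. by rewrite ler_wpM2r ?invr_ge0// ler_sum. Qed.

Lemma mean_tdist_ge0 n : 0 <= mean_dist rho' g' x' y' n.
Proof. by rewrite divr_ge0// sumr_ge0. Qed.

Lemma mean_dist_ge0 n : 0 <= mean_dist rho g x y n.
Proof. by rewrite divr_ge0// sumr_ge0. Qed.

Section Bounded.
Context (r : R).
Hypothesis dist_le : forall j, (1 <= j)%N -> dist j <= r.

Let r_ge0 : 0 <= r.
Proof. exact: le_trans (dist_ge0 1) (dist_le _). Qed.

Let r1_gt0 : 0 < r + 1.
Proof. by rewrite ltr_wpDl. Qed.

Lemma mean_dist_le n : mean_dist rho g x y n <= r.
Proof.
case: n => [|n]; first by rewrite /mean_dist invr0 mulr0.
rewrite ler_pdivrMr ?ltr0n//; apply: (@le_trans _ _ (\sum_(1 <= j < n.+2) r)).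
  by apply: ler_sum_nat => j /andP[j1 _]; exact: dist_le.
by rewrite sumr_const_nat subn1 mulr_natr.
Qed.

(** A number in [0, r] is at most r + 1 times its minimum with 1, and averages
    inherit this. *)
Lemma mean_dist_le_mean_tdist n :
  mean_dist rho g x y n <= mean_dist rho' g' x' y' n * (r + 1).
Proof.
rewrite /mean_dist mulrAC ler_wpM2r ?invr_ge0// mulr_suml.
apply: ler_sum_nat => j /andP[j1 _]; rewrite trunc.
have Dr := dist_le j1; have D0 := dist_ge0 j.
rewrite minEle; case: ifP => _; last by rewrite mul1r ler_wpDr.
by rewrite ler_peMr// lerDr.
Qed.

(** Since eps is at most r, the ratio eps / (r + 1) is below 1 and bounds its
    own square; it already bounds the truncated averages. *)
Lemma MLY_trunc eps : MLY_eps_pair rho g eps x y ->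
  MLY_eps_pair rho' g' ((eps / (r + 1)) ^+ 2) x' y'.
Proof.
case=> e0 /limn_esup_geP esup /(limn_einf_eq0P mean_dist_ge0) einf.
have er : eps <= r.
  rewrite leNgt; apply/negP => re.
  by have [k _] := esup r re 0; rewrite ltNge mean_dist_le.
have q0 : 0 < eps / (r + 1) by rewrite divr_gt0.
split; first by rewrite exprn_gt0.
- apply/limn_esup_geP => t te n.
  have /esup/(_ n)[k nk tk] : t * (r + 1) < eps.
    rewrite -ltr_pdivlMr//; apply: lt_le_trans te _.
    rewrite expr2 ler_piMr ?(ltW q0)// ler_pdivrMr// mul1r.
    by rewrite (le_trans er)// lerDl.
  exists k => //; rewrite -(ltr_pM2r r1_gt0).
  exact: lt_le_trans tk (mean_dist_le_mean_tdist k).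
- apply/(limn_einf_eq0P mean_tdist_ge0) => t t0 n.
  have [k nk kt] := einf t t0 n.
  by exists k => //; exact: le_lt_trans (mean_tdist_le k) kt.
Qed.

End Bounded.
End Truncation.

(** * Images of scrambled sets *)

Section Images.
Context {R : realType} {T T' : Type}.
Context (rho : T -> T -> R) (g : T -> T) (rho' : T' -> T' -> R) (g' : T' -> T').
Context (phi : T -> T') (S : set T).
Local Notation dist x y := (orbit_dist rho g x y).
Local Notation dist' x y := (orbit_dist rho' g' (phi x) (phi y)).
Implicit Types (P : chaos_kind) (eps c a b : R).

(** Distinct images come from distinct points. *)
Lemma pairwise_image (Q : T -> T -> Prop) (Q' : T' -> T' -> Prop) :
  (forall x y, S x -> S y -> x <> y -> Q x y -> Q' (phi x) (phi y)) ->
  pairwise_distinct Q S -> pairwise_distinct Q' (phi @` S).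
Proof.
move=> QQ' QS _ _ [x Sx <-] [y Sy <-] nxy.
have xy : x <> y by move=> xy; apply: nxy; rewrite xy.
by apply: QQ' => //; exact: QS.
Qed.

(** Agreement for thresholds up to 1 suffices, since the limit is taken at 0.
    Injectivity makes the distinct pairs of S and of its image correspond. *)
Lemma sup_Phi_image : {in S &, injective phi} ->
  (forall x y, S x -> S y -> forall delta, delta <= 1 ->
    Phi rho' g' (phi x) (phi y) delta = Phi rho g x y delta) ->
  sup_Phi rho g S @ 0^'+ --> (0 : R) ->
  sup_Phi rho' g' (phi @` S) @ 0^'+ --> (0 : R).
Proof.
move=> phi_inj PhiE; apply: cvg_trans; apply: near_eq_cvg.
near=> delta.
have d1 : delta <= 1 by near: delta; exact: nbhs_right_le.
congr sup; apply/seteqP; split=> [_ [[x y] /= [Sx Sy xy] <-]|].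
  exists (phi x, phi y); rewrite /= ?PhiE//; split; [by exists x|by exists y|].
  by move/phi_inj; rewrite !inE => /(_ Sx Sy).
move=> _ [[_ _] /= [[x Sx <-] [y Sy <-] nxy] <-].
exists (x, y); rewrite /= ?PhiE//; split=> //.
by move=> xy; apply: nxy; rewrite xy.
Unshelve. all: by end_near. Qed.

Section Isometry.
Hypothesis iso : forall x y, S x -> S y -> forall j, dist' x y j = dist x y j.

Lemma scrambled_isometry P :
  scrambled P rho g S -> scrambled P rho' g' (phi @` S).
Proof.
apply: pairwise_image => x y Sx Sy _ /chaos_pairP[e [c [a [b pxy]]]].
apply/chaos_pairP; exists e, c, a, b.
by apply: unif_pair_same pxy; exact: iso.
Qed.

Lemma unif_scrambled_isometry P eps c a b : {in S &, injective phi} ->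
  unif_scrambled P eps c a b rho g S ->
  unif_scrambled P eps c a b rho' g' (phi @` S).
Proof.
move=> phi_inj /unif_scrambledP[pS sS]; apply/unif_scrambledP; split.
  apply: pairwise_image pS => x y Sx Sy _.
  by apply: unif_pair_same; exact: iso.
move=> PE; apply: (sup_Phi_image phi_inj _ (sS PE)) => x y Sx Sy delta _.
by rewrite /Phi (_ : dist' x y = dist x y)//; apply/funext/iso.
Qed.

End Isometry.

Section Truncation.
Hypothesis dist_ge0 : forall x y j, 0 <= dist x y j.
Hypothesis trunc : forall x y, S x -> S y ->
  forall j, dist' x y j = Num.min (dist x y j) 1.

Lemma scrambled_trunc P : P <> MLY -> P <> D3 ->
  scrambled P rho g S -> scrambled P rho' g' (phi @` S).
Proof.
move=> PM PD; apply: pairwise_image => x y Sx Sy _.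
move=> /chaos_pairP[e [c [a [b pxy]]]].
apply/chaos_pairP; exists (Num.min e 1), c, a, b.
by apply: unif_pair_trunc pxy => //; exact: trunc.
Qed.

Lemma unif_scrambled_trunc P eps c a b : P <> MLY -> P <> D3 ->
  {in S &, injective phi} -> unif_scrambled P eps c a b rho g S ->
  unif_scrambled P (Num.min eps 1) c a b rho' g' (phi @` S).
Proof.
move=> PM PD phi_inj /unif_scrambledP[pS sS]; apply/unif_scrambledP; split.
  apply: pairwise_image pS => x y Sx Sy _.
  by apply: unif_pair_trunc => //; exact: trunc.
move=> PE; apply: (sup_Phi_image phi_inj _ (sS PE)) => x y Sx Sy delta d1.
by apply: Phi_trunc d1; exact: trunc.
Qed.

Lemma scrambled_MLY_trunc :
  (forall x y, S x -> S y -> exists r, forall j, (1 <= j)%N -> dist x y j <= r) ->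
  scrambled MLY rho g S -> scrambled MLY rho' g' (phi @` S).
Proof.
move=> bnd; apply: pairwise_image => x y Sx Sy _ [e pxy].
have [r xyr] := bnd x y Sx Sy; exists ((e / (r + 1)) ^+ 2).
by apply: MLY_trunc pxy => //; exact: trunc.
Qed.

Lemma unif_scrambled_MLY_trunc r eps c a b :
  (forall x y, S x -> S y -> forall j, (1 <= j)%N -> dist x y j <= r) ->
  unif_scrambled MLY eps c a b rho g S ->
  unif_scrambled MLY ((eps / (r + 1)) ^+ 2) c a b rho' g' (phi @` S).
Proof.
move=> bnd; apply: pairwise_image => x y Sx Sy _.
by apply: MLY_trunc (bnd _ _ Sx Sy) _ => //; exact: trunc.
Qed.

Lemma scrambled_D3_trunc :
  (forall x y, S x -> S y -> x <> y ->
    exists a b, a < 1 /\ D3_ab_pair rho g a b x y) ->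
  scrambled D3 rho' g' (phi @` S).
Proof.
apply: pairwise_image => x y Sx Sy _ [a [b [a1 pxy]]].
by exists a, (Num.min b 1); apply: D3_trunc pxy => //; exact: trunc.
Qed.

Lemma unif_scrambled_D3_trunc eps c a b : a < 1 ->
  unif_scrambled D3 eps c a b rho g S ->
  unif_scrambled D3 eps c a (Num.min b 1) rho' g' (phi @` S).
Proof.
move=> a1; apply: pairwise_image => x y Sx Sy _.
by apply: D3_trunc => //; exact: trunc.
Qed.

End Truncation.
End Images.

(** Uncountability is transported by equality of cardinals. *)
Lemma chaotic_image {R : realType} {T T' : Type} (P : chaos_kind)
    (Y : set T) (Y' : set T') (rho : T -> T -> R) g (rho' : T' -> T' -> R) g' :
  (forall S, S `<=` Y -> scrambled P rho g S ->
    exists S', [/\ S' `<=` Y', S' #= S & scrambled P rho' g' S']) ->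
  chaotic P Y rho g -> chaotic P Y' rho' g'.
Proof.
move=> H [S [SY cS /(H _ SY)[S' [SY' /eq_countable SS' pS']]]].
by exists S'; split=> //; rewrite SS'.
Qed.

Lemma unif_chaotic_image {R : realType} {T T' : Type} (P : chaos_kind)
    (Y : set T) (Y' : set T') (rho : T -> T -> R) g (rho' : T' -> T' -> R) g' :
  (forall S eps c a b, S `<=` Y -> unif_scrambled P eps c a b rho g S ->
    exists S' eps' b', [/\ S' `<=` Y', S' #= S
      & unif_scrambled P eps' c a b' rho' g' S']) ->
  unif_chaotic P Y rho g -> unif_chaotic P Y' rho' g'.
Proof.
move=> H [S [SY cS [eps [c [a [b pS]]]]]].
have [S' [eps' [b' [SY' /eq_countable SS' pS']]]] := H _ _ _ _ _ SY pS.
by exists S'; split=> //; [rewrite SS'|exists eps', c, a, b'].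
Qed.

(** * Hausdorff distances *)

Section Hausdorff.
Context {R : realType} {T : Type} (dist : T -> T -> R).
Hypothesis dist_ge0 : forall x y, 0 <= dist x y.
Implicit Types (A B : set T) (M : R).

Definition dist_to B x : R := inf [set dist x y | y in B].

(** One of the two halves of the Hausdorff distance, which is not symmetric. *)
Definition excess A B : R := sup [set dist_to B x | x in A].

Lemma hausdorff_distE A B :
  hausdorff_dist dist A B = Num.max (excess A B) (excess B A).
Proof. by []. Qed.

Lemma dist_to_le B x y : B y -> dist_to B x <= dist x y.
Proof. by move=> By; apply: ge_inf; [exists 0 => _ [z _ <-]|exists y]. Qed.

Lemma le_dist_to B x M : B !=set0 -> (forall y, B y -> M <= dist x y) ->
  M <= dist_to B x.
Proof.
by move=> [y By] MB; apply: lb_le_inf => [|_ [z Bz <-]]; [exists (dist x y), y|exact: MB].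
Qed.

Lemma dist_to_ge0 B x : 0 <= dist_to B x.
Proof.
have [->|/set0P B0] := eqVneq B set0; first by rewrite /dist_to image_set0 inf0.
exact: le_dist_to.
Qed.

Lemma excess_ge0 A B : 0 <= excess A B.
Proof.
rewrite /excess; set E := [set _ | _ in _].
have [[[_ [x Ax _]] Eub]|noE] := pselect (has_sup E); last by rewrite sup_out.
by apply: le_trans (dist_to_ge0 B x) _; apply: ub_le_sup => //; exists x.
Qed.

Lemma hausdorff_dist_ge0 A B : 0 <= hausdorff_dist dist A B.
Proof. by rewrite hausdorff_distE le_max excess_ge0. Qed.

Lemma excess_le A B M : A !=set0 -> (forall x, A x -> dist_to B x <= M) ->
  excess A B <= M.
Proof.
move=> [x Ax] AM; apply: ge_sup => [|_ [z Az <-]]; last exact: AM.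
by exists (dist_to B x), x.
Qed.

Lemma hausdorff_dist_le A B M : A !=set0 -> B !=set0 ->
  (forall x y, dist x y <= M) -> hausdorff_dist dist A B <= M.
Proof.
move=> A0 B0 distM; rewrite hausdorff_distE ge_max.
apply/andP; split; apply: excess_le => // x _.
  by case: B0 => y By; exact: le_trans (dist_to_le x By) (distM x y).
by case: A0 => y Ay; exact: le_trans (dist_to_le x Ay) (distM x y).
Qed.

End Hausdorff.

(** * Points as compact sets *)

Section Hyperspace.
Context {R : realType} {X : metricType R}.
Implicit Types (f : X -> X) (K L : set X) (x y : X).

Lemma d_H_ge0 K L : 0 <= d_H K L.
Proof. exact/hausdorff_dist_ge0/mdist_ge0. Qed.

Lemma d_H_set1 x y : d_H [set x] [set y] = mdist x y.
Proof.
rewrite /d_H hausdorff_distE /excess /dist_to !image_set1 !inf1 !sup1.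
by rewrite (metric_sym y x) maxxx.
Qed.

Lemma hyperspace_set1 x : hyperspace X [set x].
Proof. by split; [exists x|exact: compact_set1]. Qed.

Lemma iter_hyper_map_set1 f j x :
  iter j (hyper_map f) [set x] = [set iter j f x].
Proof. by elim: j => //= j ->; rewrite /hyper_map image_set1. Qed.

Lemma hyperspace_iter f j K : continuous f -> hyperspace X K ->
  hyperspace X (iter j (hyper_map f) K).
Proof.
move=> cf hK; elim: j => //= j [[x Kx] cK]; split; first by exists (f x), x.
by apply: continuous_compact => //; exact: continuous_subspaceT.
Qed.

(** The real supremum of an unbounded set is 0 by convention. Compactness rules
    this case out, so that the excess of K over L bounds every single distance
    from K to L; the formula for endographs relies on it. *)
Lemma compact_mdist_bounded K y : compact K ->
  exists M, forall x, K x -> mdist x y <= M.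
Proof.
move=> cK; have cd : continuous (fun x => mdist x y : R^o).
  move=> x; apply/cvgrPdist_lt => e e0.
  have /nbhs_ballP[d d0 xd] : nbhs x (ball x e) by exact: nbhsx_ballx.
  apply/nbhs_ballP; exists d => // z /xd.
  rewrite ballEmdist /= ltr_norml => xz.
  (* |d x y - d z y| <= d x z *)
  have := metric_triangle x z y; have := metric_triangle z x y.
  rewrite (metric_sym z x) -!lerBlDr => zy xy.
  rewrite ltrNl opprB (le_lt_trans _ xz)//=; last first.
  by rewrite (le_lt_trans _ xz).
have /compact_bounded[M [_ Mb]] :=
  continuous_compact (continuous_subspaceT cd) cK.
exists (M + 1) => x Kx; apply: le_trans (ler_norm _) _.
by apply: Mb; [rewrite ltrDl|exists x].
Qed.

Lemma dist_to_bounded K L : compact K -> L !=set0 ->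
  has_ubound [set dist_to mdist L x | x in K].
Proof.
move=> cK [y Ly]; have [M KM] := compact_mdist_bounded y cK.
exists M => _ [x Kx <-]; apply: le_trans (KM _ Kx).
by apply: dist_to_le Ly; exact: mdist_ge0.
Qed.

End Hyperspace.

(** * Compact sets as indicator functions *)

Section Fuzzy.
Context {R : realType} {X : metricType R}.
Implicit Types (f : X -> X) (K L : set X) (x y : X).
Local Notation ind K := (\1_K : X -> R).

Lemma ind_mem K x : K x -> ind K x = 1.
Proof. by move=> Kx; rewrite indicE mem_set. Qed.

Lemma ind_notin K x : ~ K x -> ind K x = 0.
Proof. by move=> Kx; rewrite indicE memNset. Qed.

Lemma le_ind K x (t : R) : 0 < t -> t <= 1 -> (t <= ind K x) <-> K x.
Proof.
move=> t0 t1; have [Kx|nKx] := pselect (K x); first by rewrite ind_mem.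
by rewrite ind_notin// leNgt t0.
Qed.

Lemma ind_inj : injective (fun K => ind K).
Proof.
move=> K L KL; apply/seteqP; split=> x.
  by move=> Kx; apply/(@le_ind L x 1) => //; rewrite -KL ind_mem.
by move=> Lx; apply/(@le_ind K x 1) => //; rewrite KL ind_mem.
Qed.

Lemma compact_closed_metric K : compact K -> closed K.
Proof. by move=> cK; apply: compact_closed cK; exact: metric_hausdorff. Qed.

(** At height 0 the level is a closure, which leaves the compact set K, closed
    in a metric space, unchanged. *)
Lemma level_ind K (t : R) : compact K -> 0 <= t <= 1 -> level (ind K) t = K.
Proof.
move=> cK /andP[t0 t1]; rewrite /level; case: eqVneq => [_|tn0].
  rewrite [RHS](closure_id K).1; last exact: compact_closed_metric.
  congr closure; apply/seteqP; split=> x /=; last by move=> /ind_mem ->.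
  by apply: contraPP => /ind_notin ->; rewrite ltxx.
by apply/seteqP; split=> x /=; apply le_ind; rewrite // lt_def tn0.
Qed.

Lemma fuzzy_ind K : hyperspace X K -> fuzzy_sets X (ind K).
Proof.
move=> [K0 cK]; split.
- by move=> x; rewrite indicE; case: (_ \in _); rewrite ?lexx ?ler01.
- move=> x t xt; have [Kx|nKx] := pselect (K x).
    near=> z; apply: le_lt_trans xt; rewrite (ind_mem Kx) indicE.
    by case: (_ \in _); rewrite ?lexx ?ler01.
  have : \forall z \near x, (~` K) z.
    by apply: open_nbhs_nbhs; split=> //; apply: closed_openC; exact: compact_closed_metric.
  by apply: filterS => z nKz; rewrite ind_notin// -(ind_notin nKx).
- by rewrite level_ind// lexx ler01.
- by rewrite level_ind// lexx ler01.
Unshelve. all: by end_near. Qed.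

Lemma zadeh_ind f K : zadeh f (ind K) = ind (hyper_map f K).
Proof.
apply/funext => x; rewrite /zadeh; case: asboolP => [[y yx]|nx]; last first.
  by rewrite ind_notin// => -[y _ yx]; apply: nx; exists y.
have [[z Kz zx]|nKx] := pselect (hyper_map f K x).
  rewrite ind_mem; last by exists z.
  apply/eqP; rewrite eq_le; apply/andP; split.
    apply: ge_sup; first by exists (ind K y), y.
    by move=> _ [t _ <-]; rewrite indicE; case: (_ \in _).
  apply: ub_le_sup; last by exists z => //; rewrite ind_mem.
  by exists 1 => _ [t _ <-]; rewrite indicE; case: (_ \in _).
rewrite ind_notin// (_ : _ @` _ = [set 0]) ?sup1//.
apply/seteqP; split=> [_ [t tx <-]|_ ->] /=.
  by rewrite ind_notin// => Kt; apply: nKx; exists t.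
by exists y => //; rewrite ind_notin// => Ky; apply: nKx; exists y.
Qed.

Lemma iter_zadeh_ind f j K :
  iter j (zadeh f) (ind K) = ind (iter j (hyper_map f) K).
Proof. by elim: j => //= j ->; exact: zadeh_ind. Qed.

Lemma d_infty_ind K L : compact K -> compact L ->
  d_infty (ind K) (ind L) = d_H K L.
Proof.
move=> cK cL; rewrite /d_infty (_ : [set _ | _ in _] = [set d_H K L]) ?sup1//.
apply/seteqP; split=> [_ [t + <-]|_ ->] /=.
  by rewrite ?in_itv /= => t01; rewrite !level_ind.
by exists 0; rewrite ?level_ind ?in_itv /= ?lexx ?ler01.
Qed.

(** An increasing bijection of [0, 1] fixes the end points, hence fixes every
    indicator function under composition. This is why reparametrizing the
    heights does not bring two indicators closer in d_zero. *)
Lemma incr_homeo_I01 (xi : R -> R) : incr_homeo_I xi -> xi 0 = 0 /\ xi 1 = 1.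
Proof.
case=> xi_lt [zeta [[xi01 zeta01 _ zetaK] _]].
have in0 : (0 : R) \in `[0, 1] by rewrite in_itv /= lexx ler01.
have in1 : (1 : R) \in `[0, 1] by rewrite in_itv /= lexx ler01.
split; apply/eqP.
  have := xi01 _ in0; rewrite in_itv /= eq_le => /andP[-> _]; rewrite andbT.
  have := zeta01 _ in0; rewrite in_itv /= => /andP[+ _].
  rewrite le_eqVlt => /predU1P[z0|z0]; first by rewrite [in leLHS]z0 zetaK.
  have := xi_lt _ _ in0 (zeta01 _ in0) z0; rewrite zetaK// => /ltW; exact.
have := xi01 _ in1; rewrite in_itv /= eq_le => /andP[_ ->] /=.
have := zeta01 _ in1; rewrite in_itv /= => /andP[_].
rewrite le_eqVlt => /predU1P[z1|z1]; first by rewrite -[X in xi X]z1 zetaK.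
have := xi_lt _ _ (zeta01 _ in1) in1 z1; rewrite zetaK// => /ltW; exact.
Qed.

Lemma incr_homeo_I_id : incr_homeo_I (id : R -> R).
Proof.
split=> //; exists id; split; first by split.
by split; apply: continuous_subspaceT => x; exact: cvg_id.
Qed.

Lemma d_zero_ind K L : compact K -> compact L ->
  d_zero (ind K) (ind L) = d_H K L.
Proof.
move=> cK cL; rewrite /d_zero; set E := [set e | _].
have E_le e : 0 < e -> d_H K L <= e -> E e.
  move=> e0 KLe; split=> //; exists id; split; first exact: incr_homeo_I_id.
    apply: ge_sup => [|_ [t _ <-]]; last by rewrite subrr normr0 ltW.
    by exists `|(0 : R) - 0|, 0; rewrite //= in_itv /= lexx ler01.
  by rewrite (_ : id \o _ = ind L)// d_infty_ind.
(* every reparametrization fixes \1_L and gives back d_infty *)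
have E_ge e : E e -> d_H K L <= e.
  move=> [_ [xi [/incr_homeo_I01[xi0 xi1] _]]].
  rewrite (_ : xi \o _ = ind L) ?d_infty_ind//.
  by apply/funext => x /=; rewrite indicE; case: (_ \in _).
apply/eqP; rewrite eq_le; apply/andP; split; last first.
  apply: lb_le_inf => //; exists (d_H K L + 1); apply: E_le.
    by rewrite ltr_wpDl ?d_H_ge0.
  by rewrite lerDl.
apply/ler_addgt0Pr => e e0; apply: ge_inf; first by exists (d_H K L).
by apply: E_le; rewrite ?ltr_wpDl ?d_H_ge0// lerDl ltW.
Qed.

Lemma dbar_ge0 (p q : X * R) : 0 <= dbar p q.
Proof. by rewrite le_max mdist_ge0. Qed.

Lemma dbar_same_height x y (t : R) : dbar (x, t) (y, t) = mdist x y.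
Proof. by rewrite /dbar /= subrr normr0 max_l ?mdist_ge0. Qed.

Lemma dbar_same_point x (s t : R) : dbar (x, s) (x, t) = `|s - t|.
Proof. by rewrite /dbar /= mdistxx max_r. Qed.

Lemma sendograph_ind K : compact K ->
  sendograph (ind K) = K `*` [set t | 0 <= t <= 1].
Proof.
move=> cK; rewrite /sendograph level_ind ?lexx ?ler01//.
apply/seteqP; split=> [[x t] /= [[t01 _] [Kx _]]//|[x t] /= [Kx t01]].
by do !split=> //=; rewrite ?in_itv//= ind_mem//; case/andP: t01.
Qed.

(** Above a point of K or L the sendograph is a full vertical segment, so nearest
    points can be sought at equal heights. *)
Lemma excess_sendograph K L : compact K -> compact L -> L !=set0 ->
  excess dbar (sendograph (ind K)) (sendograph (ind L)) = excess mdist K L.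
Proof.
move=> cK cL [y0 Ly0]; rewrite !sendograph_ind//.
have distE x t : 0 <= t <= 1 ->
    dist_to dbar (L `*` [set t | 0 <= t <= 1]) (x, t) = dist_to mdist L x.
  move=> t01; apply/eqP; rewrite eq_le; apply/andP; split.
    apply: le_dist_to => [|y Ly]; first by exists y0.
    by rewrite -(dbar_same_height x y t); apply: dist_to_le => //; exact: dbar_ge0.
  apply: le_dist_to => [|[y s] /= [Ly _]]; first by exists (y0, t).
  rewrite le_max (dist_to_le _ x Ly)//; exact: mdist_ge0.
congr sup; apply/seteqP; split=> [_ [[x t] /= [Kx t01] <-]|_ [x Kx <-]].
  by exists x => //; rewrite distE.
by exists (x, 0) => /=; rewrite ?distE ?lexx ?ler01.
Qed.

Lemma d_send_ind K L : hyperspace X K -> hyperspace X L ->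
  d_send (ind K) (ind L) = d_H K L.
Proof.
move=> [K0 cK] [L0 cL].
by rewrite /d_send /d_H !hausdorff_distE !excess_sendograph.
Qed.

(** Every endograph contains the floor X * {0}, so a point (x, t) above K
    either moves horizontally to L * [0, 1] or drops to the floor at cost t. *)
Lemma dist_to_endograph_ind L x (t : R) : 0 <= t <= 1 -> L !=set0 ->
  dist_to dbar (endograph (ind L)) (x, t) = Num.min (dist_to mdist L x) t.
Proof.
move=> /andP[t0 t1] L0.
have floor z : endograph (ind L) (z, 0).
  by split=> /=; rewrite ?lexx ?ler01// indicE; case: (_ \in _).
apply/eqP; rewrite eq_le; apply/andP; split.
  rewrite le_min; apply/andP; split.
    apply: le_dist_to => // y Ly; rewrite -(dbar_same_height x y t).
    apply: dist_to_le; first exact: dbar_ge0.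
    by split; rewrite /= ?t0// ind_mem.
  rewrite -[leRHS](ger0_norm t0) -[t in leRHS]subr0 -(dbar_same_point x t 0).
  by apply: dist_to_le; first exact: dbar_ge0.
apply: le_dist_to => [|[y s] /= [/andP[s0 s1] sL]]; first by exists (x, 0).
have [Ly|nLy] := pselect (L y).
  rewrite ge_min; apply/orP; left; rewrite le_max.
  by apply/orP; left; apply: dist_to_le => //; exact: mdist_ge0.
move: sL; rewrite ind_notin// => sle0.
have -> : s = 0 by apply/eqP; rewrite eq_le s0 sle0.
by rewrite ge_min !le_max /= subr0 ger0_norm// lexx !orbT.
Qed.

(** The supremum over the heights t in [0, 1] of min (distance to L) t is reached
    at t = 1. *)
Lemma excess_endograph K L : hyperspace X K -> L !=set0 ->
  excess dbar (endograph (ind K)) (endograph (ind L)) =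
  Num.min (excess mdist K L) 1.
Proof.
move=> [[x0 Kx0] cK] L0; have KLub := dist_to_bounded cK L0.
have top x : K x -> endograph (ind K) (x, 1).
  by move=> Kx; split; rewrite /= ?lexx ?ler01// ind_mem.
have d0 := @mdist_ge0 R X.
have ub p : endograph (ind K) p ->
    dist_to dbar (endograph (ind L)) p <= Num.min (excess mdist K L) 1.
  case: p => x t [/= /andP[t0 t1] tK]; rewrite dist_to_endograph_ind ?t0//.
  have [Kx|nKx] := pselect (K x).
    rewrite le_min !ge_min t1 orbT andbT; apply/orP; left.
    by apply: ub_le_sup => //; exists x.
  move: tK; rewrite ind_notin// => tle0.
  by rewrite (le_trans _ (_ : 0 <= _)) ?le_min ?excess_ge0 ?ler01// ge_min tle0 orbT.
apply/eqP; rewrite eq_le; apply/andP; split.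
  by apply: excess_le => //; exists (x0, 1); exact: top.
have Ex x : K x -> Num.min (dist_to mdist L x) 1 <=
    excess dbar (endograph (ind K)) (endograph (ind L)).
  move=> Kx; rewrite -dist_to_endograph_ind ?ler01 ?lexx//.
  apply: ub_le_sup; last by exists (x, 1) => //; exact: top.
  by exists (Num.min (excess mdist K L) 1) => _ [p Kp <-]; exact: ub.
rewrite ge_min; have [_|lt1] := leP 1 (excess dbar _ _); first by rewrite orbT.
apply/orP; left; apply: excess_le => [|x Kx]; first by exists x0.
by have := Ex x Kx; rewrite ge_min [1 <= _]leNgt lt1 orbF.
Qed.

Lemma d_end_ind K L : hyperspace X K -> hyperspace X L ->
  d_end (ind K) (ind L) = Num.min (d_H K L) 1.
Proof.
move=> hK hL; rewrite /d_end /d_H !hausdorff_distE.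
by rewrite !excess_endograph ?min_maxl//; [case: hK|case: hL].
Qed.

End Fuzzy.

(** * The two embeddings along the orbits *)

Section Embeddings.
Context {R : realType} {X : metricType R} (f : X -> X).
Hypothesis cf : continuous f.
Implicit Types (P : chaos_kind) (S : set X) (SK : set (set X)) (K L : set X).
Implicit Types (rho : (X -> R) -> (X -> R) -> R) (eps c a b r : R).
Local Notation ind := (fun K : set X => \1_K : X -> R).

Lemma singleton_inj : injective (@set1 X).
Proof. by move=> x y xy; have : [set y] x by rewrite -xy. Qed.

Lemma orbit_set1 x y j :
  orbit_dist d_H (hyper_map f) [set x] [set y] j = orbit_dist mdist f x y j.
Proof. by rewrite /orbit_dist !iter_hyper_map_set1 d_H_set1. Qed.

Lemma orbit_ind rho K L j : [\/ rho = d_infty, rho = d_zero | rho = d_send] ->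
  hyperspace X K -> hyperspace X L ->
  orbit_dist rho (zadeh f) (ind K) (ind L) j = orbit_dist d_H (hyper_map f) K L j.
Proof.
move=> rhoE hK hL; rewrite /orbit_dist !iter_zadeh_ind.
have hKj := hyperspace_iter j cf hK; have hLj := hyperspace_iter j cf hL.
case: rhoE => ->; last exact: d_send_ind.
  by rewrite d_infty_ind; [|case: hKj|case: hLj].
by rewrite d_zero_ind; [|case: hKj|case: hLj].
Qed.

Lemma orbit_ind_end K L j : hyperspace X K -> hyperspace X L ->
  orbit_dist d_end (zadeh f) (ind K) (ind L) j =
  Num.min (orbit_dist d_H (hyper_map f) K L j) 1.
Proof.
by move=> hK hL; rewrite /orbit_dist !iter_zadeh_ind d_end_ind//;
  exact: hyperspace_iter.
Qed.

Lemma orbit_d_H_ge0 K L j : 0 <= orbit_dist d_H (hyper_map f) K L j.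
Proof. exact: d_H_ge0. Qed.

Lemma orbit_d_H_le r K L j : (forall x y : X, mdist x y <= r) ->
  hyperspace X K -> hyperspace X L -> orbit_dist d_H (hyper_map f) K L j <= r.
Proof.
move=> Xr hK hL; have [K0 _] := hyperspace_iter j cf hK.
have [L0 _] := hyperspace_iter j cf hL.
by apply: hausdorff_dist_le => //; exact: mdist_ge0.
Qed.

Lemma set1_image_sub S : set1 @` S `<=` hyperspace X.
Proof. by move=> _ [x _ <-]; exact: hyperspace_set1. Qed.

Lemma set1_image_card S : set1 @` S #= S.
Proof. by apply: inj_card_eq => x y _ _; exact: singleton_inj. Qed.

Lemma ind_image_sub SK : SK `<=` hyperspace X -> ind @` SK `<=` fuzzy_sets X.
Proof. by move=> SKh _ [K /SKh hK <-]; exact: fuzzy_ind. Qed.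

Lemma ind_image_card SK : ind @` SK #= SK.
Proof. by apply: inj_card_eq => K L _ _; exact: ind_inj. Qed.

Lemma scrambled_hyper P S : scrambled P mdist f S ->
  scrambled P d_H (hyper_map f) (set1 @` S).
Proof. by apply: scrambled_isometry => x y _ _ j; exact: orbit_set1. Qed.

Lemma unif_scrambled_hyper P eps c a b S : unif_scrambled P eps c a b mdist f S ->
  unif_scrambled P eps c a b d_H (hyper_map f) (set1 @` S).
Proof.
apply: unif_scrambled_isometry => [x y _ _ j|x y _ _]; first exact: orbit_set1.
exact: singleton_inj.
Qed.

Section Fuzzy.
Context (SK : set (set X)).
Hypothesis hSK : SK `<=` hyperspace X.

Let ind_injS : {in SK &, injective ind}.
Proof. by move=> K L _ _; exact: ind_inj. Qed.

Lemma scrambled_fuzzy P rho : [\/ rho = d_infty, rho = d_zero | rho = d_send] ->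
  scrambled P d_H (hyper_map f) SK -> scrambled P rho (zadeh f) (ind @` SK).
Proof.
move=> rhoE; apply: scrambled_isometry => K L /hSK hK /hSK hL j.
exact: orbit_ind.
Qed.

Lemma unif_scrambled_fuzzy P eps c a b rho :
  [\/ rho = d_infty, rho = d_zero | rho = d_send] ->
  unif_scrambled P eps c a b d_H (hyper_map f) SK ->
  unif_scrambled P eps c a b rho (zadeh f) (ind @` SK).
Proof.
move=> rhoE; apply: unif_scrambled_isometry => // K L /hSK hK /hSK hL j.
exact: orbit_ind.
Qed.

Lemma trunc_end K L : SK K -> SK L -> forall j,
  orbit_dist d_end (zadeh f) (ind K) (ind L) j =
  Num.min (orbit_dist d_H (hyper_map f) K L j) 1.
Proof. by move=> /hSK hK /hSK hL j; exact: orbit_ind_end. Qed.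

(** In a space of diameter at most 1 truncation is void, so every notion of
    chaos is transported, including those for which truncation would be an
    obstacle. *)
Lemma isometry_end : (forall x y : X, mdist x y <= 1) ->
  forall K L, SK K -> SK L -> forall j,
  orbit_dist d_end (zadeh f) (ind K) (ind L) j =
  orbit_dist d_H (hyper_map f) K L j.
Proof.
move=> X1 K L SKK SKL j; rewrite trunc_end// min_l//.
by apply: orbit_d_H_le => //; exact: hSK.
Qed.

Lemma scrambled_end P : P <> MLY -> P <> D3 ->
  scrambled P d_H (hyper_map f) SK -> scrambled P d_end (zadeh f) (ind @` SK).
Proof. exact: (scrambled_trunc orbit_d_H_ge0 trunc_end). Qed.

Lemma unif_scrambled_end P eps c a b : P <> MLY -> P <> D3 ->
  unif_scrambled P eps c a b d_H (hyper_map f) SK ->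
  unif_scrambled P (Num.min eps 1) c a b d_end (zadeh f) (ind @` SK).
Proof.
by move=> PM PD; exact: (unif_scrambled_trunc orbit_d_H_ge0 trunc_end).
Qed.

Lemma scrambled_MLY_end :
  (forall K L, SK K -> SK L -> exists M : R, forall j, (1 <= j)%N ->
    d_H (iter j (hyper_map f) K) (iter j (hyper_map f) L) <= M) ->
  scrambled MLY d_H (hyper_map f) SK ->
  scrambled MLY d_end (zadeh f) (ind @` SK).
Proof. exact: (scrambled_MLY_trunc orbit_d_H_ge0 trunc_end). Qed.

Lemma unif_scrambled_MLY_end r eps c a b :
  (forall K L, SK K -> SK L -> forall j, (1 <= j)%N ->
    d_H (iter j (hyper_map f) K) (iter j (hyper_map f) L) <= r) ->
  unif_scrambled MLY eps c a b d_H (hyper_map f) SK ->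
  unif_scrambled MLY ((eps / (r + 1)) ^+ 2) c a b d_end (zadeh f) (ind @` SK).
Proof. exact: (unif_scrambled_MLY_trunc orbit_d_H_ge0 trunc_end). Qed.

Lemma scrambled_D3_end :
  (forall K L, SK K -> SK L -> K <> L -> exists a b : R,
    a < 1 /\ D3_ab_pair d_H (hyper_map f) a b K L) ->
  scrambled D3 d_end (zadeh f) (ind @` SK).
Proof. exact: (scrambled_D3_trunc trunc_end). Qed.

Lemma unif_scrambled_D3_end eps c a b : a < 1 ->
  unif_scrambled D3 eps c a b d_H (hyper_map f) SK ->
  unif_scrambled D3 eps c a (Num.min b 1) d_end (zadeh f) (ind @` SK).
Proof. exact: (unif_scrambled_D3_trunc trunc_end). Qed.

End Fuzzy.
End Embeddings.

Lemma diam_le1 {R : realType} {X : metricType R} :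
  (diam X <= 1%:E)%E -> forall x y : X, mdist x y <= 1.
Proof. by move=> /ereal_supP X1 x y; rewrite -lee_fin; apply: X1; exists (x, y). Qed.

Theorem theorem3p1 (R : realType) (X : metricType R) (f : X -> X)
    (hf : continuous f) (eps c a b r : R) (heps : 0 < eps) (hc : 0 < c)
    (hb : 0 < b) (hr : 0 < r) (ha : 0 <= a) (hab : a < b) :
  (* (a) *)
  (forall (P : chaos_kind) (S : set X),
    (scrambled P mdist f S ->
      exists Sbar : set (set X),
        [/\ Sbar `<=` hyperspace X, Sbar #= S
          & scrambled P d_H (hyper_map f) Sbar]) /\
    (unif_scrambled P eps c a b mdist f S ->
      exists Sbar : set (set X),
        [/\ Sbar `<=` hyperspace X, Sbar #= S
          & unif_scrambled P eps c a b d_H (hyper_map f) Sbar]))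
  /\
  (* (b) *)
  (forall (P : chaos_kind) (Sbar : set (set X)), Sbar `<=` hyperspace X ->
    (scrambled P d_H (hyper_map f) Sbar ->
      exists Shat : set (X -> R),
        [/\ Shat `<=` fuzzy_sets X, Shat #= Sbar
          & forall rho : (X -> R) -> (X -> R) -> R,
              [\/ rho = d_infty, rho = d_zero | rho = d_send] ->
              scrambled P rho (zadeh f) Shat]) /\
    (unif_scrambled P eps c a b d_H (hyper_map f) Sbar ->
      exists Shat : set (X -> R),
        [/\ Shat `<=` fuzzy_sets X, Shat #= Sbar
          & forall rho : (X -> R) -> (X -> R) -> R,
              [\/ rho = d_infty, rho = d_zero | rho = d_send] ->
              unif_scrambled P eps c a b rho (zadeh f) Shat]))
  /\
  (* (c) *)
  (forall (P : chaos_kind) (Sbar : set (set X)), Sbar `<=` hyperspace X ->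
    P = LY \/ P = D1 \/ P = D1half \/ P = D2 \/ P = D2half ->
    (scrambled P d_H (hyper_map f) Sbar ->
      exists Shat : set (X -> R),
        [/\ Shat `<=` fuzzy_sets X, Shat #= Sbar
          & scrambled P d_end (zadeh f) Shat]) /\
    (unif_scrambled P eps c a b d_H (hyper_map f) Sbar ->
      exists Shat : set (X -> R),
        [/\ Shat `<=` fuzzy_sets X, Shat #= Sbar
          & unif_scrambled P (Num.min eps 1) c a b d_end (zadeh f) Shat]))
  /\
  (* (d) *)
  (forall Sbar : set (set X), Sbar `<=` hyperspace X ->
    (scrambled MLY d_H (hyper_map f) Sbar ->
      (forall K L, Sbar K -> Sbar L ->
        exists M : R, forall j, (1 <= j)%N ->
          d_H (iter j (hyper_map f) K) (iter j (hyper_map f) L) <= M) ->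
      exists Shat : set (X -> R),
        [/\ Shat `<=` fuzzy_sets X, Shat #= Sbar
          & scrambled MLY d_end (zadeh f) Shat]) /\
    (unif_scrambled MLY eps c a b d_H (hyper_map f) Sbar ->
      (forall K L, Sbar K -> Sbar L -> forall j, (1 <= j)%N ->
          d_H (iter j (hyper_map f) K) (iter j (hyper_map f) L) <= r) ->
      exists Shat : set (X -> R),
        [/\ Shat `<=` fuzzy_sets X, Shat #= Sbar
          & unif_scrambled MLY ((eps / (r + 1)) ^+ 2) c a b
              d_end (zadeh f) Shat]))
  /\
  (* (e) *)
  (forall Sbar : set (set X), Sbar `<=` hyperspace X ->
    (scrambled D3 d_H (hyper_map f) Sbar ->
      (forall K L, Sbar K -> Sbar L -> K <> L ->
        exists aKL bKL : R,
          aKL < 1 /\ D3_ab_pair d_H (hyper_map f) aKL bKL K L) ->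
      exists Shat : set (X -> R),
        [/\ Shat `<=` fuzzy_sets X, Shat #= Sbar
          & scrambled D3 d_end (zadeh f) Shat]) /\
    (unif_scrambled D3 eps c a b d_H (hyper_map f) Sbar -> a < 1 ->
      exists Shat : set (X -> R),
        [/\ Shat `<=` fuzzy_sets X, Shat #= Sbar
          & unif_scrambled D3 eps c a (Num.min b 1) d_end (zadeh f) Shat]))
  /\
  (* (f) *)
  (forall P : chaos_kind,
    (chaotic P [set: X] mdist f ->
      chaotic P (hyperspace X) d_H (hyper_map f)) /\
    (unif_chaotic P [set: X] mdist f ->
      unif_chaotic P (hyperspace X) d_H (hyper_map f)))
  /\
  (* (g) *)
  (forall (P : chaos_kind) (rho : (X -> R) -> (X -> R) -> R),
    [\/ rho = d_infty, rho = d_zero | rho = d_send] ->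
    (chaotic P (hyperspace X) d_H (hyper_map f) ->
      chaotic P (fuzzy_sets X) rho (zadeh f)) /\
    (unif_chaotic P (hyperspace X) d_H (hyper_map f) ->
      unif_chaotic P (fuzzy_sets X) rho (zadeh f)))
  /\
  (* (h) *)
  (forall P : chaos_kind, P = LY \/ P = D1 \/ P = D1half \/ P = D2 \/ P = D2half ->
    (chaotic P (hyperspace X) d_H (hyper_map f) ->
      chaotic P (fuzzy_sets X) d_end (zadeh f)) /\
    (unif_chaotic P (hyperspace X) d_H (hyper_map f) ->
      unif_chaotic P (fuzzy_sets X) d_end (zadeh f)))
  /\
  (* (i) *)
  (bounded_space X ->
    (chaotic MLY (hyperspace X) d_H (hyper_map f) ->
      chaotic MLY (fuzzy_sets X) d_end (zadeh f)) /\
    (unif_chaotic MLY (hyperspace X) d_H (hyper_map f) ->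
      unif_chaotic MLY (fuzzy_sets X) d_end (zadeh f)))
  /\
  (* (j) *)
  ((diam X <= 1%:E)%E ->
    (chaotic D3 (hyperspace X) d_H (hyper_map f) ->
      chaotic D3 (fuzzy_sets X) d_end (zadeh f)) /\
    (unif_chaotic D3 (hyperspace X) d_H (hyper_map f) ->
      unif_chaotic D3 (fuzzy_sets X) d_end (zadeh f))).
Proof.
have notMLYD3 P : P = LY \/ P = D1 \/ P = D1half \/ P = D2 \/ P = D2half ->
    P <> MLY /\ P <> D3.
  by case=> [->|[->|[->|[->|->]]]].
pose toF (SK : set (set X)) : set (X -> R) := (fun K => \1_K) @` SK.
have subF SK : SK `<=` hyperspace X -> toF SK `<=` fuzzy_sets X.
  exact: ind_image_sub.
have cardF SK : toF SK #= SK by exact: ind_image_card.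
split; [|split; [|split; [|split; [|split; [|split; [|split; [|split; [|split]]]]]]]].
- move=> P S; split=> pS; exists (set1 @` S); split.
  + exact: set1_image_sub.
  + exact: set1_image_card.
  + exact: scrambled_hyper.
  + exact: set1_image_sub.
  + exact: set1_image_card.
  + exact: unif_scrambled_hyper.
- move=> P SK hSK; split=> pS; exists (toF SK); split.
  + exact: subF.
  + exact: cardF.
  + by move=> rho rhoE; exact: scrambled_fuzzy.
  + exact: subF.
  + exact: cardF.
  + by move=> rho rhoE; exact: unif_scrambled_fuzzy.
- move=> P SK hSK /notMLYD3[PM PD]; split=> pS; exists (toF SK); split.
  + exact: subF.
  + exact: cardF.
  + exact: scrambled_end.
  + exact: subF.
  + exact: cardF.
  + exact: unif_scrambled_end.
- move=> SK hSK; split=> pS bnd; exists (toF SK); split.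
  + exact: subF.
  + exact: cardF.
  + exact: scrambled_MLY_end.
  + exact: subF.
  + exact: cardF.
  + exact: unif_scrambled_MLY_end.
- move=> SK hSK; split=> pS a1; exists (toF SK); split.
  + exact: subF.
  + exact: cardF.
  + exact: scrambled_D3_end.
  + exact: subF.
  + exact: cardF.
  + exact: unif_scrambled_D3_end.
- move=> P; split.
    apply: chaotic_image => S _ pS; exists (set1 @` S); split.
    + exact: set1_image_sub.
    + exact: set1_image_card.
    + exact: scrambled_hyper.
  apply: unif_chaotic_image => S e c' a' b' _ pS.
  exists (set1 @` S), e, b'; split.
  + exact: set1_image_sub.
  + exact: set1_image_card.
  + exact: unif_scrambled_hyper.
- move=> P rho rhoE; split.
    apply: chaotic_image => SK hSK pS; exists (toF SK); split.
    + exact: subF.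
    + exact: cardF.
    + exact: scrambled_fuzzy.
  apply: unif_chaotic_image => SK e c' a' b' hSK pS.
  exists (toF SK), e, b'; split.
  + exact: subF.
  + exact: cardF.
  + exact: unif_scrambled_fuzzy.
- move=> P /notMLYD3[PM PD]; split.
    apply: chaotic_image => SK hSK pS; exists (toF SK); split.
    + exact: subF.
    + exact: cardF.
    + exact: scrambled_end.
  apply: unif_chaotic_image => SK e c' a' b' hSK pS.
  exists (toF SK), (Num.min e 1), b'; split.
  + exact: subF.
  + exact: cardF.
  + exact: unif_scrambled_end.
- move=> [M XM].
  have bnd SK : SK `<=` hyperspace X -> forall K L, SK K -> SK L ->
      forall j, (1 <= j)%N ->
      d_H (iter j (hyper_map f) K) (iter j (hyper_map f) L) <= M.
    by move=> hSK K L /hSK hK /hSK hL j _; exact: orbit_d_H_le.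
  split.
    apply: chaotic_image => SK hSK pS; exists (toF SK); split.
    + exact: subF.
    + exact: cardF.
    + apply: scrambled_MLY_end => // K L SKK SKL.
      by exists M; exact: (bnd SK).
  apply: unif_chaotic_image => SK e c' a' b' hSK pS.
  (* the constant of [MLY_trunc] for the bound M on the distances *)
  exists (toF SK), ((e / (M + 1)) ^+ 2), b'; split.
  + exact: subF.
  + exact: cardF.
  + by apply: unif_scrambled_MLY_end => //; exact: bnd.
- move=> /diam_le1 X1; split.
    apply: chaotic_image => SK hSK pS; exists (toF SK); split.
    + exact: subF.
    + exact: cardF.
    + exact: (scrambled_isometry (isometry_end hf hSK X1)).
  apply: unif_chaotic_image => SK e c' a' b' hSK pS.
  exists (toF SK), e, b'; split.
  + exact: subF.
  + exact: cardF.
  + apply: (unif_scrambled_isometry (isometry_end hf hSK X1)) => //.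
    by move=> K L _ _; exact: ind_inj.
Qed.
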